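(* For all integers $J\ge 0$ and $N\ge 0$, $$MO(-2,11J+4;11N+6)\equiv 0\pmod{11}.$$
   Context: For an integer $a$ and a nonnegative integer $t$, define $MO(a,t;n)$ by the formal power series identity $$\sum_{n\ge 0}MO(a,t;n)\,q^n=\sum_{1\le n_1<n_2<\cdots<n_t}\frac{q^{n_1+n_2+\cdots+n_t}}{\prod_{k=1}^t(1+aq^{n_k}+q^{2n_k})},$$ where each factor $1/(1+aq^{m}+q^{2m})$ is expanded as a power series in $q$ with integer coefficients. *)

(* Defs.v *)
From HB Require Import structures.
From mathcomp Require Import all_boot all_order all_algebra.
From mathcomp Require Import boolp.

Set Implicit Arguments.
Unset Strict Implicit.
Unset Printing Implicit Defensive.

Import GRing.Theory.
Local Open Scope ring_scope.

(* The ring R[[q]] of formal power series; [coefps f n] is the coefficient of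
   q^n in f. *)
Record powerseries (R : comUnitRingType) := PowerSeries { coefps : nat -> R }.

HB.instance Definition _ (R : comUnitRingType) := gen_eqMixin (powerseries R).
HB.instance Definition _ (R : comUnitRingType) :=
  gen_choiceMixin (powerseries R).

Section PowerSeriesRing.
Variable R : comUnitRingType.
Implicit Types f g h u : powerseries R.

Lemma psP f g : coefps f =1 coefps g -> f = g.
Proof. by case: f g => [f] [g] /= /funext ->. Qed.

Definition ps0 : powerseries R := PowerSeries (fun=> 0).
Definition psopp f := PowerSeries (fun n => - coefps f n).
Definition psadd f g := PowerSeries (fun n => coefps f n + coefps g n).

Lemma psaddA : associative psadd.
Proof. by move=> f g h; apply: psP => n /=; rewrite addrA. Qed.
Lemma psaddC : commutative psadd.
Proof. by move=> f g; apply: psP => n /=; rewrite addrC. Qed.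
Lemma psadd0 : left_id ps0 psadd.
Proof. by move=> f; apply: psP => n /=; rewrite add0r. Qed.
Lemma psaddN : left_inverse ps0 psopp psadd.
Proof. by move=> f; apply: psP => n /=; rewrite addNr. Qed.

HB.instance Definition _ :=
  GRing.isZmodule.Build (powerseries R) psaddA psaddC psadd0 psaddN.

Definition ps1 : powerseries R := PowerSeries (fun n => (n == 0)%:R).
Definition psmul f g :=
  PowerSeries (fun n => \sum_(i < n.+1) coefps f i * coefps g (n - i)).

Definition pstrunc m f : {poly R} := \poly_(i < m) coefps f i.

Lemma coef_pstrunc m f i : (i < m)%N -> (pstrunc m f)`_i = coefps f i.
Proof. by move=> lt_im; rewrite coef_poly lt_im. Qed.

Lemma coef_pstruncM m f g n : (n < m)%N ->
  (pstrunc m f * pstrunc m g)`_n = coefps (psmul f g) n.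
Proof.
move=> lt_nm; rewrite coefM; apply: eq_bigr => i _.
rewrite !coef_pstrunc ?(leq_ltn_trans (leq_subr _ _)) //.
exact: leq_trans (ltn_ord i) lt_nm.
Qed.

Lemma psmulA : associative psmul.
Proof.
move=> f g h; apply: psP => n; set T := pstrunc n.+1.
transitivity ((T f * (T g * T h))`_n).
  rewrite coefM; apply: eq_bigr => i _.
  by rewrite coef_pstrunc // coef_pstruncM // ltnS leq_subr.
rewrite mulrA coefM; apply: eq_bigr => i _.
by rewrite coef_pstruncM // coef_pstrunc // ltnS leq_subr.
Qed.

Lemma psmulC : commutative psmul.
Proof.
by move=> f g; apply: psP => n; rewrite -!(@coef_pstruncM n.+1) // mulrC.
Qed.

Lemma psmul1 : left_id ps1 psmul.
Proof.
move=> f; apply: psP => n /=; rewrite big_ord_recl /= mul1r subn0.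
by rewrite big1 ?addr0 // => i _; rewrite mul0r.
Qed.

Lemma psmulDl : left_distributive psmul psadd.
Proof.
move=> f g h; apply: psP => n /=; rewrite -big_split /=.
by apply: eq_bigr => i _; rewrite mulrDl.
Qed.

Lemma ps1_neq0 : ps1 != 0.
Proof.
apply/eqP => /(congr1 (fun f => coefps f 0)) /= /eqP.
by rewrite oner_eq0.
Qed.

HB.instance Definition _ := GRing.Zmodule_isComNzRing.Build (powerseries R)
  psmulA psmulC psmul1 psmulDl ps1_neq0.

Lemma coefps0 n : coefps (0 : powerseries R) n = 0. Proof. by []. Qed.
Lemma coefps1 n : coefps (1 : powerseries R) n = (n == 0)%:R. Proof. by []. Qed.
Lemma coefpsD f g n : coefps (f + g) n = coefps f n + coefps g n.
Proof. by []. Qed.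
Lemma coefpsN f n : coefps (- f) n = - coefps f n. Proof. by []. Qed.
Lemma coefpsM f g n :
  coefps (f * g) n = \sum_(i < n.+1) coefps f i * coefps g (n - i).
Proof. by []. Qed.
Lemma coefps_sum (I : Type) (r : seq I) (P : pred I)
    (F : I -> powerseries R) n :
  coefps (\sum_(i <- r | P i) F i) n = \sum_(i <- r | P i) coefps (F i) n.
Proof. exact: (big_morph _ (fun f g => coefpsD f g n) (coefps0 n)). Qed.

Lemma coefps0M f g : coefps (f * g) 0 = coefps f 0 * coefps g 0.
Proof. by rewrite coefpsM big_ord1. Qed.

(* The series with constant term c. *)
Definition psC (c : R) : powerseries R :=
  PowerSeries (fun n => if n == 0 then c else 0).

Lemma coefpsCM c f n : coefps (psC c * f) n = c * coefps f n.
Proof.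
rewrite coefpsM big_ord_recl subn0 big1 ?addr0 // => i _.
by rewrite mul0r.
Qed.

Definition psunit : pred (powerseries R) :=
  fun f => coefps f 0 \is a GRing.unit.

(* The geometric expansion 1/f = f_0^-1 * (1 + u + u^2 + ...) with
   u = 1 - f_0^-1 f; since u has no constant term, only u^0, ..., u^n
   contribute to the coefficient of q^n. *)
Definition psgeom f : powerseries R :=
  let c := (coefps f 0)^-1 in
  PowerSeries (fun n => c * coefps (\sum_(j < n.+1) (1 - psC c * f) ^+ j) n).

Definition psinv f := if psunit f then psgeom f else f.

Lemma coefpsX_small u j n : coefps u 0 = 0 -> (n < j)%N -> coefps (u ^+ j) n = 0.
Proof.
move=> u0; elim: j n => // j IHj n lt_nj.
rewrite exprS coefpsM big_ord_recl u0 mul0r add0r big1 // => i _.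
rewrite IHj ?mulr0 // lift0; apply: (@leq_trans n) => //.
by rewrite ltn_subrL /= (leq_ltn_trans _ (ltn_ord i)).
Qed.

Lemma psgeomK f : psunit f -> psgeom f * f = 1.
Proof.
move=> uf; set c := (coefps f 0)^-1; set u := 1 - psC c * f.
have u0 : coefps u 0 = 0.
  by rewrite coefpsD coefpsN coefpsCM coefps1 mulVr // subrr.
apply: psP => n.
have geomE i : (i <= n)%N ->
    coefps (psgeom f) i = coefps (psC c * \sum_(j < n.+1) u ^+ j) i.
  move=> le_in; rewrite coefpsCM /= -/c -/u; congr (_ * _).
  rewrite !coefps_sum (big_ord_widen _ (fun j => coefps (u ^+ j) i) (le_in : i.+1 <= n.+1)%N).
  rewrite big_mkcond; apply: eq_bigr => j _.
  by case: ifP => // /negbT; rewrite -leqNgt => /(coefpsX_small u0) ->.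
transitivity (coefps (psC c * (\sum_(j < n.+1) u ^+ j) * f) n).
  by rewrite !coefpsM; apply: eq_bigr => i _; rewrite geomE // -ltnS.
rewrite mulrC mulrA [f * _]mulrC.
have -> : psC c * f = 1 - u by rewrite /u opprB addrCA subrr addr0.
have -> : (1 - u) * (\sum_(j < n.+1) u ^+ j) = 1 - u ^+ n.+1.
  by move: u {u0 geomE} => u; rewrite -[RHS]opprB subrX1 -[RHS]mulNr opprB.
by rewrite coefpsD coefpsN coefpsX_small // subr0.
Qed.

Lemma psinvK : {in psunit, left_inverse 1 psinv *%R}.
Proof. by move=> f uf; rewrite /psinv [psunit f]uf psgeomK. Qed.

Lemma psunitP f g : g * f = 1 -> psunit f.
Proof.
move=> /(congr1 (fun h => coefps h 0)); rewrite coefps0M coefps1 => gf1.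
by apply/unitrPr; exists (coefps g 0); rewrite mulrC.
Qed.

Lemma psinv_out : {in [predC psunit], psinv =1 id}.
Proof. by move=> f nuf; rewrite /psinv [psunit f](negbTE nuf). Qed.

HB.instance Definition _ := GRing.ComNzRing_hasMulInverse.Build (powerseries R)
  psinvK psunitP psinv_out.

Lemma psunitE f : (f \is a GRing.unit) = (coefps f 0 \is a GRing.unit).
Proof. by []. Qed.

(* The indeterminate q. *)
Definition psX : powerseries R := PowerSeries (fun n => (n == 1)%:R).

Lemma coefps_psXn m n : coefps (psX ^+ m) n = (n == m)%:R.
Proof.
elim: m n => [|m IHm] n; first by rewrite expr0 coefps1.
rewrite exprS coefpsM; case: n => [|n]; first by rewrite big_ord1 mul0r.
rewrite big_ord_recl mul0r add0r big_ord_recl mul1r IHm subSS subn0.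
by rewrite eqSS big1 ?addr0 // => i _; rewrite mul0r.
Qed.

Lemma coefps_psXnM_small m f n : (n < m)%N -> coefps (psX ^+ m * f) n = 0.
Proof.
move=> lt_nm; rewrite coefpsM big1 // => i _.
rewrite coefps_psXn (_ : (i == m :> nat) = false) ?mul0r //.
by apply/ltn_eqF/(leq_trans (ltn_ord i)).
Qed.

End PowerSeriesRing.

Section MO.
Variable a : int.

Definition MO_factor (m : nat) : powerseries int :=
  1 + a%:~R * psX int ^+ m + psX int ^+ (2 * m).

(* The summand indexed by s = (n_1, ..., n_t). *)
Definition MO_term (s : seq nat) : powerseries int :=
  psX int ^+ (\sum_(m <- s) m) / \prod_(m <- s) MO_factor m.

(* The sum of the terms with 1 <= n_1 < ... < n_t <= B. *)
Definition MO_partial (t B : nat) : powerseries int :=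
  \sum_(s : t.-tuple 'I_B.+1 | path ltn 0 (map val s)) MO_term (map val s).

(* The sum over all 1 <= n_1 < ... < n_t: a term with n_t > n does not
   contribute to the coefficient of q^n, so the coefficients of the partial
   sums are eventually constant (see [MO_series_lim]). *)
Definition MO_series (t : nat) : powerseries int :=
  PowerSeries (fun n => coefps (MO_partial t n) n).

Definition MO (t n : nat) : int := coefps (MO_series t) n.

Lemma MO_factor_unit m : (0 < m)%N -> MO_factor m \is a GRing.unit.
Proof.
move=> m_gt0; rewrite psunitE !coefpsD coefps0M !coefps_psXn.
by rewrite ![0%N == _]eq_sym muln_eq0 /= eqn0Ngt m_gt0 mulr0 !addr0.
Qed.

Lemma coef_MO_term_small s m n :
  m \in s -> (n < m)%N -> coefps (MO_term s) n = 0.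
Proof.
move=> ms lt_nm; apply: coefps_psXnM_small; apply: leq_trans lt_nm _.
by rewrite (big_rem m ms) leq_addr.
Qed.

Lemma MO_series_lim t n B :
  (n <= B)%N -> coefps (MO_partial t B) n = coefps (MO_series t) n.
Proof.
move=> le_nB; rewrite /= !coefps_sum.
have le_nB1 : (n.+1 <= B.+1)%N by [].
pose w (s : t.-tuple 'I_n.+1) : t.-tuple 'I_B.+1 :=
  [tuple of map (widen_ord le_nB1) s].
pose r (s : t.-tuple 'I_B.+1) : t.-tuple 'I_n.+1 :=
  [tuple of map (inord \o val) s].
have valw s : map val (w s) = map val s by rewrite -map_comp.
have wK : cancel w r.
  move=> s; apply: val_inj; rewrite /= -map_comp -[RHS]map_id.
  by apply: eq_map => i; apply: val_inj; rewrite /= inordK.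
rewrite (bigID (fun s : t.-tuple 'I_B.+1 => all (leq^~ n) (map val s))) /=.
rewrite [X in _ + X]big1 ?addr0; last first.
  move=> s /andP[_ /allPn[m ms]]; rewrite -ltnNge => lt_nm.
  exact: coef_MO_term_small lt_nm.
rewrite (reindex_onto w r) /=; last first.
  move=> s /andP[_ /allP s_le]; apply: val_inj; rewrite /= -map_comp -[RHS]map_id.
  apply/eq_in_map => i si; apply: val_inj; rewrite /= inordK //.
  by rewrite ltnS s_le // map_f.
apply: eq_big => [s|s _]; rewrite ?valw // wK eqxx andbT.
suff -> : all (leq^~ n) (map val s) by rewrite andbT.
by apply/allP => _ /mapP[i _ ->]; rewrite -ltnS ltn_ord.
Qed.

End MO.

(* Main.v *)
Require Import Defs.
From HB Require Import structures.
From mathcomp Require Import all_boot all_order all_algebra.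
From mathcomp Require Import finfield.
From mathcomp Require Import ring zify.
Set Implicit Arguments.
Unset Strict Implicit.
Unset Printing Implicit Defensive.
Import GRing.Theory.
Local Open Scope ring_scope.

(* Put phi = prod_m (1 - q^m).  For a = -2 the factor attached to m is
   (1 - q^m)^2, so the generating function of the MO(-2, t; .) in t is
   phi^-2 prod_m ((1 - q^m)^2 + v q^m).  Writing v = 2 - x - 1/x, the Jacobi
   triple product turns this into
     phi^3 sum_n MO(-2, t; n) q^n
       = sum_n +- (2n+1)/(2t+1) C(n+t, 2t) q^(n(n+1)/2).
   If t = 4 mod 11, the coefficient on the right is nonzero mod 11 only for
   n = 4, 6 mod 11, where n(n+1)/2 = 10 mod 11.  As phi^11 is mod 11 a series in
   q^11, it remains to see that the coefficients of phi^8 at exponents 7 mod 11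
   vanish mod 11.  Expand 96 phi^9 as a triple sum by Jacobi's identity for
   phi^3 and split it along the direction (1, 1, 1): the pentagonal number
   theorem yields a factor phi and leaves 96 phi^8 as a sum over the lattice A_2
   of a product of three linear forms, the exponent e being given by
   9e + 3 = x^2 + xy + y^2 for two of these forms.  This form is anisotropic
   mod 11, so e = 7 mod 11 forces 11 to divide the product. *)

(** * Truncated equality and Gaussian binomials *)

Section Trunc.
Variable R : comUnitRingType.
Implicit Types f g h : powerseries R.

(** Congruence modulo q^(N+1): infinite products and series are replaced by truncations compared to
    this order. *)
Definition eqtrunc N f g := forall n, (n <= N)%N -> coefps f n = coefps g n.

Global Arguments eqtrunc : simpl never.

Lemma eqtrunc_refl N f : eqtrunc N f f. Proof. by []. Qed.
Lemma eq_eqtrunc N f g : f = g -> eqtrunc N f g. Proof. by move=> ->. Qed.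
Lemma eqtrunc_sym N f g : eqtrunc N f g -> eqtrunc N g f.
Proof. by move=> fg n le_nN; rewrite fg. Qed.
Lemma eqtrunc_trans N g f h : eqtrunc N f g -> eqtrunc N g h -> eqtrunc N f h.
Proof. by move=> fg gh n le_nN; rewrite fg ?gh. Qed.
Lemma eqtrunc_le M N f g : (M <= N)%N -> eqtrunc N f g -> eqtrunc M f g.
Proof. by move=> le_MN fg n le_nM; apply/fg/(leq_trans le_nM). Qed.
Lemma eqtruncD N f g f' g' :
  eqtrunc N f g -> eqtrunc N f' g' -> eqtrunc N (f + f') (g + g').
Proof. by move=> fg fg' n le_nN; rewrite !coefpsD fg ?fg'. Qed.
Lemma eqtruncM N f g f' g' :
  eqtrunc N f g -> eqtrunc N f' g' -> eqtrunc N (f * f') (g * g').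
Proof.
move=> fg fg' n le_nN; rewrite !coefpsM; apply: eq_bigr => i _.
by rewrite fg ?fg' // (leq_trans _ le_nN) ?leq_subr // -ltnS.
Qed.
Lemma eqtruncX N f g k : eqtrunc N f g -> eqtrunc N (f ^+ k) (g ^+ k).
Proof. by move=> fg; elim: k => // k IHk; rewrite !exprS; apply: eqtruncM. Qed.
Lemma eqtrunc_sum N (I : Type) (r : seq I) (P : pred I) (F G : I -> powerseries R) :
  (forall i, P i -> eqtrunc N (F i) (G i)) ->
  eqtrunc N (\sum_(i <- r | P i) F i) (\sum_(i <- r | P i) G i).
Proof.
move=> FG n le_nN; rewrite !coefps_sum.
by apply: eq_bigr => i Pi; apply: FG.
Qed.
Lemma eqtruncXn m N f g :
  eqtrunc N f g -> eqtrunc (m + N) (psX R ^+ m * f) (psX R ^+ m * g).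
Proof.
move=> fg n le_n; rewrite !coefpsM; apply: eq_bigr => i _; rewrite coefps_psXn.
case: eqP => [im|_]; last by rewrite !mul0r.
by rewrite fg // im leq_subLR.
Qed.
Lemma eqtruncXn0 m N f : (N < m)%N -> eqtrunc N (psX R ^+ m * f) 0.
Proof.
by move=> lt_Nm n le_nN; rewrite coefps_psXnM_small ?coefps0 // (leq_ltn_trans le_nN).
Qed.

Definition euler B : powerseries R := \prod_(1 <= m < B.+1) (1 - psX R ^+ m).

Lemma euler0 : euler 0 = 1. Proof. by rewrite /euler big_geq. Qed.
Lemma eulerS B : euler B.+1 = euler B * (1 - psX R ^+ B.+1).
Proof. by rewrite /euler big_nat_recr. Qed.

Lemma euler_coef0 B : coefps (euler B) 0 = 1.
Proof.
elim: B => [|B IHB]; first by rewrite euler0.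
by rewrite eulerS coefps0M IHB coefpsD coefpsN coefps_psXn subr0 mulr1.
Qed.

Lemma euler_unit B : euler B \is a GRing.unit.
Proof. by rewrite psunitE euler_coef0 unitr1. Qed.

Lemma euler_trunc B C : (B <= C)%N -> eqtrunc B (euler C) (euler B).
Proof.
elim: C => [|C IHC]; first by rewrite leqn0 => /eqP ->.
rewrite leq_eqVlt => /orP[/eqP -> //|]; rewrite ltnS => le_BC.
apply: eqtrunc_trans (IHC le_BC) => n le_nB.
rewrite eulerS mulrBr mulr1 coefpsD coefpsN mulrC coefps_psXnM_small ?subr0 //.
by rewrite ltnS (leq_trans le_nB).
Qed.

Fixpoint gbin n k : powerseries R :=
  match n, k with
  | _, 0 => 1
  | 0, _.+1 => 0
  | n'.+1, k'.+1 => gbin n' k' + psX R ^+ k * gbin n' k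
  end.

Lemma gbin0 n : gbin n 0 = 1. Proof. by case: n. Qed.
Lemma gbinS n k : gbin n.+1 k.+1 = gbin n k + psX R ^+ k.+1 * gbin n k.+1.
Proof. by []. Qed.
Lemma gbin_small n k : (n < k)%N -> gbin n k = 0.
Proof.
elim: n k => [|n IHn] [|k] //; rewrite ltnS => lt_nk.
by rewrite gbinS !IHn ?mulr0 ?addr0 // ltnW.
Qed.

(** The q-factorial formula without denominators; the induction rests on 1 - q^(n+1) = (1 - q^(k+1))
    + q^(k+1) (1 - q^(n-k)). *)
Lemma gbin_euler n k : (k <= n)%N -> gbin n k * euler k * euler (n - k) = euler n.
Proof.
elim: n k => [|n IHn] [|k] //; rewrite ?euler0 ?gbin0 ?mul1r ?subn0 ?euler0 //.
rewrite ltnS => le_kn; rewrite gbinS subSS.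
have := IHn k le_kn; rewrite !eulerS.
move: le_kn; rewrite leq_eqVlt => /orP[/eqP -> |lt_kn].
  rewrite (@gbin_small n n.+1) // mulr0 addr0 => e; rewrite -[in RHS]e; ring.
have := IHn k.+1 lt_kn; rewrite subnS -[(n - k)%N]prednK ?subn_gt0 //.
rewrite !eulerS !prednK ?subn_gt0 // => e1 e2.
have -> : euler n * (1 - psX R ^+ n.+1)
   = euler n * (1 - psX R ^+ k.+1) + psX R ^+ k.+1 * (1 - psX R ^+ (n - k)) * euler n.
  rewrite -[in n.+1](subnK (ltnW lt_kn)) -addnS exprD; ring.
rewrite -{1}e2 -e1; ring.
Qed.

Lemma gbinnn n : gbin n n = 1.
Proof.
have /(congr1 (fun f => f / euler n)) := @gbin_euler n n (leqnn n).
by rewrite subnn euler0 mulr1 mulrK ?divrr ?euler_unit.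
Qed.

Lemma gbinSr n k : (k <= n)%N ->
  gbin n.+1 k.+1 = psX R ^+ (n - k) * gbin n k + gbin n k.+1.
Proof.
rewrite leq_eqVlt => /orP[/eqP ->|lt_kn].
  by rewrite subnn mul1r !gbinnn gbin_small // addr0.
apply: (mulIr (euler_unit k.+1)); apply: (mulIr (euler_unit (n - k))).
rewrite -subSS gbin_euler ?ltnS 1?ltnW // subSS mulrDl [RHS]mulrDl.
have := gbin_euler (ltnW lt_kn); have := gbin_euler lt_kn.
rewrite subnS -[(n - k)%N]prednK ?subn_gt0 // !eulerS !prednK ?subn_gt0 // => e1 e2.
transitivity (euler n * (psX R ^+ (n - k) * (1 - psX R ^+ k.+1) + (1 - psX R ^+ (n - k)))).
  by rewrite -[in n.+1](subnK (ltnW lt_kn)) -addnS exprD; ring.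
by rewrite mulrDr -{1}e2 -e1; ring.
Qed.

Lemma gbin_pascal2 M K : (K.+1 <= M.+1)%N ->
  gbin (2 * M).+3 K.+2 = psX R ^+ (2 * M + 1 - K) * gbin (2 * M).+1 K
   + (1 + psX R ^+ (2 * M).+2) * gbin (2 * M).+1 K.+1
   + psX R ^+ K.+2 * gbin (2 * M).+1 K.+2.
Proof.
move=> le_KM; rewrite gbinS [gbin (2 * M).+2 K.+1]gbinSr ?[gbin (2 * M).+2 K.+2]gbinSr; try lia.
rewrite mulrDr !mulrA -exprD.
have -> : (K.+2 + ((2 * M).+1 - K.+1) = (2 * M).+2)%N by lia.
have -> : ((2 * M).+1 - K = 2 * M + 1 - K)%N by lia.
ring.
Qed.

(* With v = 2 - x - 1/x, [jac n] is (-1)^n (x^-n + x^(1-n) + ... + x^n) as a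
   polynomial in v = 'X. *)
Fixpoint jac n : {poly R} :=
  match n with
  | 0 => 1
  | n'.+1 => match n' with
    | 0 => 'X - 3%:R%:P
    | n''.+1 => ('X - 2%:R%:P) * jac n' - jac n''
    end
  end.

Lemma jacSS n : jac n.+2 = ('X - 2%:R%:P) * jac n.+1 - jac n.
Proof. by []. Qed.

(** The sum of binomials is (2n+1)/(2t+1) C(n+t, 2t) without division. Two consecutive n are carried
    along, as the recurrence has order two. *)
Lemma coef_jac n t :
  (jac n)`_t = (-1) ^+ (n + t) * ('C(n + t + 1, 2 * t + 1) + 'C(n + t, 2 * t + 1))%:R.
Proof.
suff H : forall t, (jac n)`_t = (-1) ^+ (n + t) * ('C(n + t + 1, 2 * t + 1) + 'C(n + t, 2 * t + 1))%:R
   /\ (jac n.+1)`_t = (-1) ^+ (n.+1 + t) * ('C(n.+1 + t + 1, 2 * t + 1) + 'C(n.+1 + t, 2 * t + 1))%:R.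
  by case: (H t).
elim: n => [|n IHn] {}t.
  rewrite /= coefB coefC coefX coef1.
  case: t => [|[|t]].
  - by split; rewrite /= ?bin1; ring.
  - have [c0 c1] : ('C(0 + 1 + 1, 2 * 1 + 1) + 'C(0 + 1, 2 * 1 + 1) = 0 /\
      'C(1 + 1 + 1, 2 * 1 + 1) + 'C(1 + 1, 2 * 1 + 1) = 1)%N by [].
    by rewrite c0 c1; split => /=; ring.
  - by split; rewrite /= ?subr0 !bin_small ?mulr0 //; lia.
split; first by case: (IHn t).
rewrite jacSS coefB mulrBl coefB coefXM coefCM; case: (IHn t) => -> ->.
case: t => [|t] /=.
  rewrite !addn0 !muln0 !bin1 !natrD !exprS; move: ((-1) ^+ n) => s.
  by rewrite -!natr1; ring.
case: (IHn t) => _ ->.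
rewrite !(addSn, addnS, addn0, mul2n, doubleS) !exprS; move: ((-1) ^+ (n + t)) => s.
rewrite !binS !natrD; ring.
Qed.
End Trunc.

(** * A finite form of the Jacobi triple product *)

Definition tri n := 'C(n.+1, 2).
Lemma triS n : tri n.+1 = (tri n + n.+1)%N.
Proof. by rewrite /tri binS bin1. Qed.
Lemma tri2 n : (2 * tri n = n * n.+1)%N.
Proof. by elim: n => // n IHn; rewrite triS mulnDr IHn; ring. Qed.

Section JacobiTriple.
Variable R : comUnitRingType.

Lemma gbin_sym n k : (k <= n)%N -> gbin R n k = gbin R n (n - k).
Proof.
move=> le_kn; apply: (mulIr (euler_unit R k)); apply: (mulIr (euler_unit R (n - k))).
rewrite gbin_euler // -[RHS]mulrA [euler R k * _]mulrC mulrA.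
by have := @gbin_euler R _ _ (leq_subr k n); rewrite subKn.
Qed.

Lemma gbin_pascal2_1 n :
  gbin R n.+2 1 = 1 + psX R ^+ n.+1 + psX R * gbin R n 1.
Proof.
rewrite gbinS gbin0 gbinSr // gbin0 subn0 mulr1 mulrDr -exprD.
by rewrite expr1 addrA add1n.
Qed.

(* The weight with which [jac n] enters the product over m <= M. *)
Definition jacw M n : powerseries R :=
  if (n <= M)%N then psX R ^+ tri n * gbin R (2 * M).+1 (M - n) else 0.

(** The new factor is (1 + q^(2M+2)) + q^(M+1) (v - 2), and v - 2 sends [jac n] to the sum of its
    neighbours. Up to powers of q the rule is [gbin_pascal2]. *)
Lemma jacwS M n : jacw M.+1 n.+1 =
  (1 + psX R ^+ (2 * M).+2) * jacw M n.+1
   + psX R ^+ M.+1 * (jacw M n + jacw M n.+2).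
Proof.
have M2 : (2 * M.+1).+1 = (2 * M).+3 by lia.
rewrite /jacw ltnS M2 subSS.
case: (leqP n M) => [le_nM|lt_Mn]; last first.
  have [-> ->] : (n < M)%N = false /\ (n.+1 < M)%N = false by lia.
  by ring.
case: (ltngtP n.+1 M) => [lt_nM|lt_Mn|eq_nM]; last 2 first.
- have -> : n = M by lia.
  by rewrite subnn !gbin0 triS exprD; ring.
- rewrite -eq_nM subSnn subnn !gbin0 gbin_pascal2_1 !triS !exprD.
  by rewrite !exprS; ring.
have -> : (M - n = (M - n.+2).+2)%N by lia.
have -> : (M - n.+1 = (M - n.+2).+1)%N by lia.
rewrite gbin_pascal2; last by lia.
have -> : (2 * M + 1 - (M - n.+2) = M + n + 3)%N by lia.
move: (gbin _ _ (M - n.+2)) (gbin _ _ (M - n.+2).+1) (gbin _ _ (M - n.+2).+2) => a b c.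
have -> : psX R ^+ M.+1 = psX R ^+ (M - n.+2).+2 * psX R ^+ n.+1.
  by rewrite -exprD; congr (_ ^+ _); lia.
have -> : psX R ^+ (M + n + 3) = psX R ^+ (M - n.+2).+2 * psX R ^+ n.+1 * psX R ^+ n.+2.
  by rewrite -!exprD; congr (_ ^+ _); lia.
by rewrite !triS !exprD !exprS; ring.
Qed.

Lemma jacw0 M : jacw M.+1 0 =
  (1 + psX R ^+ (2 * M).+2) * jacw M 0 + psX R ^+ M.+1 * (jacw M 0 + jacw M 1).
Proof.
have M2 : (2 * M.+1).+1 = (2 * M).+3 by lia.
rewrite /jacw !leq0n M2 !subn0 /tri bin_small // binn !expr0 !mul1r.
case: M {M2} => [|M]; first by rewrite muln0 gbin_pascal2_1 gbin0 gbinnn /=; ring.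
rewrite gbin_pascal2 // ltn0Sn subSS subn0 (@gbin_sym _ M.+2); last by lia.
have -> : ((2 * M.+1).+1 - M.+2 = M.+1)%N by lia.
have -> : (2 * M.+1 + 1 - M = M.+3)%N by lia.
by rewrite !exprS; ring.
Qed.

Let Q := jac (powerseries R).

(** The convention 0.-1 = 0 is right here: run backwards, the recurrence gives [jac 0] at index
    -1. *)
Lemma jac_mulX n : ('X - 2%:R%:P) * Q n = Q n.+1 + Q n.-1.
Proof. by case: n => [|n]; rewrite /Q ?jacSS /=; ring. Qed.

Lemma finite_jacobi M L : (M < L)%N ->
  \prod_(1 <= m < M.+1) (((1 - psX R ^+ m) ^+ 2)%:P + (psX R ^+ m)%:P * 'X)
  = \sum_(n < L) jacw M n *: Q n.
Proof.
elim: M L => [|M IHM] L lt_ML.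
  rewrite big_geq // -(subnKC lt_ML) big_split_ord /= big_ord1 big1 ?addr0.
    by rewrite /jacw leqnn subnn gbin0 mulr1 scale1r.
  by move=> i _; rewrite /jacw scale0r.
case: L lt_ML => // L; rewrite ltnS => lt_ML.
rewrite big_nat_recr //= (IHM L.+1) 1?ltnW //.
set c := psX R ^+ M.+1; set d := (1 + psX R ^+ (2 * M).+2).
have jacw_out n : (M < n)%N -> jacw M n = 0.
  by move=> lt_Mn; rewrite /jacw leqNgt lt_Mn.
have -> : ((1 - c) ^+ 2)%:P + c%:P * 'X = (d%:P + c%:P * ('X - 2%:R%:P)).
  have -> : d = 1 + c ^+ 2 by rewrite -exprM; congr (1 + _ ^+ _); lia.
  by rewrite !(rmorphXn, rmorphB, rmorphD, rmorph1) /=; ring.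
pose S0 := \sum_(n < L.+1) (d * jacw M n) *: Q n.
pose S1 := \sum_(n < L) (c * jacw M n) *: Q n.+1.
pose S2 := \sum_(n < L) (c * jacw M n.+1) *: Q n.
transitivity (S0 + (S1 + ((c * jacw M 0) *: Q 0 + S2))).
  transitivity (S0 + (\sum_(n < L.+1) (c * jacw M n) *: Q n.+1
                      + \sum_(n < L.+1) (c * jacw M n) *: Q n.-1)).
    rewrite mulr_suml -!big_split /=; apply: eq_bigr => n _.
    by rewrite -!mul_polyC !polyCM -mulrDr -jac_mulX; ring.
  congr (_ + (_ + _)); first by rewrite big_ord_recr /= jacw_out // mulr0 scale0r addr0.
  by rewrite big_ord_recl.
transitivity (S0 + (\sum_(n < L.+1) (c * jacw M n.-1) *: Q n
                    + \sum_(n < L.+1) (c * jacw M n.+1) *: Q n)).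
  congr (_ + _); rewrite big_ord_recl big_ord_recr /= [jacw M L.+1]jacw_out 1?ltnW //.
  by rewrite mulr0 scale0r addr0 /S1 /S2 addrCA addrA.
rewrite -!big_split /=; apply: eq_bigr => n _.
rewrite -!scalerDl; congr (_ *: _); rewrite -mulrDr.
by case: (val n) => [|m]; rewrite ?jacw0 ?jacwS.
Qed.

(** All Euler products in [gbin_euler] agree with [euler (M - n)] to order M - n. *)
Lemma gbin_euler_trunc M n : (n <= M)%N ->
  eqtrunc (M - n) (gbin R (2 * M).+1 (M - n) * euler R M) 1.
Proof.
move=> le_nM; have := @gbin_euler R (2 * M).+1 (M - n).
have -> : ((2 * M).+1 - (M - n) = M + n.+1)%N by lia.
move=> /(_ ltac:(lia)) e.
have t C : (M - n <= C)%N -> eqtrunc (M - n) (euler R C) (euler R (M - n)).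
  exact: euler_trunc.
set E := euler R (M - n) in e t *; set X := gbin _ _ _ * _.
have uE : E * E \is a GRing.unit by rewrite unitrM euler_unit.
rewrite -[X](mulrK uE) -(divrr uE); apply: eqtruncM => //.
apply: (eqtrunc_trans (g := X * (E * euler R (M + n.+1)))).
  by apply: eqtruncM => //; apply: eqtruncM => //; apply/eqtrunc_sym/t; lia.
have -> : X * (E * euler R (M + n.+1)) = euler R (2 * M).+1 * euler R M.
  by rewrite -e /X; ring.
by apply: eqtruncM; apply: t; lia.
Qed.

(** The n orders lost in [gbin_euler_trunc] are regained from q^(tri n), as n <= tri n. *)
Lemma jacw_trunc M n : eqtrunc M (euler R M * jacw M n) (psX R ^+ tri n).
Proof.
have n_tri : (n <= tri n)%N by case: n => // n; rewrite triS leq_addl.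
rewrite /jacw; case: leqP => [le_nM|lt_Mn]; last first.
  rewrite mulr0 -[psX R ^+ _]mulr1; apply/eqtrunc_sym/eqtruncXn0.
  exact: leq_trans n_tri.
rewrite mulrCA -[X in eqtrunc _ _ X]mulr1 [euler _ _ * _]mulrC.
apply: (@eqtrunc_le R M (tri n + (M - n))); first lia.
exact/eqtruncXn/gbin_euler_trunc.
Qed.

Lemma jacobi_trunc B t :
  eqtrunc B
   (euler R B * (\prod_(1 <= m < B.+1)
      (((1 - psX R ^+ m) ^+ 2)%:P + (psX R ^+ m)%:P * 'X))`_t)
   (\sum_(n < B.+1) (Q n)`_t * psX R ^+ tri n).
Proof.
rewrite (@finite_jacobi B B.+1) // coef_sum mulr_sumr.
apply: eqtrunc_sum => n _; rewrite coefZ mulrA mulrC.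
exact/eqtruncM/jacw_trunc.
Qed.

(** Jacobi's identity: at v = 0, that is x = 1, each factor is (1 - q^m)^2. *)
Lemma euler_cube B : eqtrunc B (euler R B ^+ 3)
  (\sum_(n < B.+1) ((-1) ^+ n * (2 * n + 1)%:R) * psX R ^+ tri n).
Proof.
have := @jacobi_trunc B 0; rewrite -horner_coef0 horner_prod.
under eq_bigr => m _ do rewrite hornerD hornerM hornerX mulr0 addr0 hornerC.
rewrite prodrXl -exprS => /eqtrunc_trans; apply.
apply: eqtrunc_sum => n _; rewrite coef_jac !addn0 !muln0 !bin1.
by have -> : (n + 1 + n = 2 * n + 1)%N by lia.
Qed.
End JacobiTriple.

(** * The generating function of MO(-2, t; n) *)

Section IncreasingTuples.
Variables (K : comNzRingType) (x : nat -> K) (B : nat).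

(** Elementary symmetric function of degree t in x_(lo+1), ..., x_B, indexed as in [MO_partial]; the
    free lower bound serves the induction. *)
Definition incsum t lo : K :=
  \sum_(s : t.-tuple 'I_B.+1 | path ltn lo (map val s)) \prod_(m <- map val s) x m.

Lemma incsum0 lo : incsum 0 lo = 1.
Proof.
rewrite /incsum (big_pred1 [tuple]) /= ?big_nil // => s.
by rewrite tuple0 /= eqxx.
Qed.

Lemma incsumS t lo :
  incsum t.+1 lo = \sum_(i < B.+1 | (lo < i)%N) x i * incsum t i.
Proof.
rewrite /incsum; under [RHS]eq_bigr => i _ do rewrite mulr_sumr.
rewrite pair_big_dep /=.
rewrite (reindex (fun p : 'I_B.+1 * t.-tuple 'I_B.+1 => cons_tuple p.1 p.2)) /=.
  by apply: eq_big => [[i s]|[i s] _] //=; rewrite big_cons.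
exists (fun s : t.+1.-tuple 'I_B.+1 => (thead s, [tuple of behead s])).
  by move=> [i s] _; congr (_, _); apply: val_inj.
by move=> s _; apply: val_inj; rewrite /= [in RHS](tuple_eta s).
Qed.

Lemma incsum_rec t lo : (lo < B)%N ->
  incsum t.+1 lo = x lo.+1 * incsum t lo.+1 + incsum t.+1 lo.+1.
Proof.
move=> lt_loB; rewrite !incsumS.
have lt_lo : (lo.+1 < B.+1)%N by [].
rewrite (bigD1 (Ordinal lt_lo)) //=; congr (_ + _); apply: eq_bigl => i.
by rewrite -val_eqE /=; lia.
Qed.

Lemma incsum_prod t lo : (lo <= B)%N ->
  incsum t lo = (\prod_(lo.+1 <= m < B.+1) (1 + (x m)%:P * 'X))`_t.
Proof.
move=> le_loB; rewrite -(subKn le_loB); move: (B - lo)%N => k {le_loB}.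
elim: k t => [|k IHk] t.
  rewrite subn0 big_geq // coef1; case: t => [|t]; first by rewrite incsum0.
  by rewrite incsumS big_pred0 // => i; have := ltn_ord i; lia.
case: (leqP B k) => [le_Bk|lt_kB].
  have -> : (B - k.+1 = B - k)%N by lia.
  exact: IHk.
have e : (B - k = (B - k.+1).+1)%N by lia.
rewrite big_ltn; last by lia.
rewrite mulrDl mul1r coefD -mulrA coefCM coefXM -e -IHk.
case: t => [|t]; first by rewrite !incsum0 mulr0 addr0.
by rewrite /= -IHk [LHS]incsum_rec -?e 1?addrC //; lia.
Qed.
End IncreasingTuples.

Lemma MO_factorE m : MO_factor (-2) m = (1 - psX int ^+ m) ^+ 2.
Proof. by rewrite /MO_factor mulnC exprM; ring. Qed.

Lemma MO_partialE t B :
  MO_partial (-2) t B = (\prod_(1 <= m < B.+1)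
     (1 + (psX int ^+ m / MO_factor (-2) m)%:P * 'X))`_t.
Proof.
rewrite -incsum_prod //; apply: eq_bigr => s lt_s; rewrite /MO_term.
have {lt_s} : all (fun m => 0 < m)%N (map val s).
  by apply: (order_path_min ltn_trans).
elim: (map val s) => [|m r IHr] /=; first by rewrite !big_nil expr0 divr1.
case/andP=> m_gt0 r_gt0; rewrite !big_cons -(IHr r_gt0) exprD invrM ?MO_factor_unit //.
  by rewrite [X in _ * X]mulrC mulrACA.
rewrite big_seq; apply: rpred_prod => i i_r.
by rewrite MO_factor_unit // (allP r_gt0).
Qed.

(** Two factors phi clear the denominators (1 - q^m)^2; the third belongs to the triple product. *)
Lemma MO_euler t B :
  eqtrunc B (euler int B ^+ 3 * MO_series (-2) t)
   (\sum_(n < B.+1) (jac (powerseries int) n)`_t * psX int ^+ tri n).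
Proof.
apply: (eqtrunc_trans (g := euler int B ^+ 3 * MO_partial (-2) t B)).
  by apply: eqtruncM => // n le_nB; rewrite MO_series_lim.
apply: (eqtrunc_trans _ (@jacobi_trunc int B t)).
rewrite exprS -mulrA MO_partialE -coefCM /euler -prodrXl rmorph_prod /= -big_split /=.
rewrite (@eq_big_nat _ _ _ 1 B.+1 _ (fun m => ((1 - psX int ^+ m) ^+ 2)%:P + (psX int ^+ m)%:P * 'X)) //.
move=> m /andP[m_gt0 _]; rewrite mulrDr mulr1 mulrA -polyCM -MO_factorE.
by rewrite mulrCA divrr ?mulr1 // MO_factor_unit.
Qed.

(** * The pentagonal number theorem *)

Section Pentagonal.
Variable R : comUnitRingType.

(* Shanks's finite form of the pentagonal number theorem: summed over s <= n
   these terms give the partial pentagonal sum, while all terms with s > 0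
   vanish modulo q^(n+1). *)
Definition shanks_term n s : powerseries R :=
  (-1) ^+ s * (euler R n / euler R s) * psX R ^+ (s * n + tri s).

Lemma shanks_termS n s :
  shanks_term n s.+1 * (1 - psX R ^+ s.+1) = - shanks_term n s * psX R ^+ (n + s.+1).
Proof.
have u : 1 - psX R ^+ s.+1 \is a GRing.unit.
  by rewrite psunitE coefpsD coefpsN coefps_psXn subr0 coefps1 unitr1.
rewrite /shanks_term triS eulerS invrM ?euler_unit // mulSn; move: (tri s) => T.
rewrite !exprD [(-1) ^+ _]exprS.
move: (psX R ^+ s.+1) u => c u.
transitivity (- ((-1) ^+ s * (euler R n / euler R s) * (psX R ^+ (s * n) * psX R ^+ T)
    * (psX R ^+ n * c) * ((1 - c)^-1 * (1 - c)))); last by rewrite mulVr // mulr1; ring.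
by ring.
Qed.

Lemma shanks n :
  \sum_(s < n.+1) shanks_term n s =
  \sum_(s < n.+1) (-1) ^+ s * psX R ^+ (3 * tri s - s)
   + \sum_(s < n) (-1) ^+ s.+1 * psX R ^+ (3 * tri s + s.+1).
Proof.
elim: n => [|n IHn].
  by rewrite !big_ord1 big_ord0 /shanks_term euler0 divr1 mulr1 addr0.
have t2 := tri2 n; have t2S := triS n.
rewrite [in RHS]big_ord_recr [X in _ = _ + X]big_ord_recr /= addrACA -IHn.
rewrite big_ord_recr /= -[LHS](subrK (\sum_(s < n.+1) shanks_term n s)) [RHS]addrC.
congr (_ + _); rewrite addrAC -sumrB [LHS]addrC; congr (_ + _).
  rewrite /shanks_term divrr ?euler_unit // mulr1; congr (_ * _ ^+ _); lia.
(* The terms for n + 1 and n differ by b (s+1) - b s. As b 0 = 0, only b (n+1) survives: the new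
   term of the second sum. *)
pose b s := shanks_term n s * (1 - psX R ^+ s).
transitivity (\sum_(0 <= s < n.+1) (b s.+1 - b s)).
  rewrite big_mkord; apply: eq_bigr => s _; rewrite /b shanks_termS.
  rewrite /shanks_term eulerS mulnS addnS; move: (tri s) => T.
  by rewrite !exprS !exprD; ring.
rewrite telescope_sumr // /b shanks_termS subrr mulr0 subr0.
rewrite /shanks_term divrr ?euler_unit // mulr1 -mulNr -mulrA -exprD exprS mulN1r.
by congr (_ * _ ^+ _); lia.
Qed.

Lemma euler_pentagonal B : eqtrunc B (euler R B)
  (\sum_(s < B.+1) (-1) ^+ s * psX R ^+ (3 * tri s - s)
   + \sum_(s < B) (-1) ^+ s.+1 * psX R ^+ (3 * tri s + s.+1)).
Proof.
rewrite -shanks big_ord_recl /= => n le_nB; rewrite coefpsD coefps_sum big1 => [|s _].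
  by rewrite /shanks_term euler0 divr1 !mul1r mulr1 addr0.
rewrite /shanks_term mulrC coefps_psXnM_small // /bump leq0n add1n triS.
nia.
Qed.
End Pentagonal.

(** The integers from -(B+1) to B, a box stable under k |-> -1-k, so that terms paired by this
    reflection stay together. *)
Definition ibox B : seq int := map Posz (iota 0 B.+1) ++ map Negz (iota 0 B.+1).

Lemma mem_ibox B k : (k \in ibox B) = (- (B%:Z + 1) <= k <= B%:Z).
Proof.
rewrite mem_cat; apply/orP/idP => [[]/mapP[n] | ].
- by rewrite mem_iota => n_B ->; lia.
- by rewrite mem_iota => n_B ->; lia.
by case: k => k k_B; [left|right]; apply: map_f; rewrite mem_iota; lia.
Qed.

Lemma ibox_uniq B : uniq (ibox B).
Proof.
rewrite cat_uniq !map_inj_uniq ?iota_uniq; [|by move=> ? ? []..].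
by rewrite andbT; apply/hasPn => k /mapP[n _ ->]; apply/mapP => -[].
Qed.

Lemma big_ibox (V : nmodType) B (F : int -> V) :
  \sum_(k <- ibox B) F k = \sum_(n < B.+1) (F (Posz n) + F (Negz n)).
Proof.
rewrite big_split /= big_cat !big_map -[iota 0 B.+1]/(index_iota 0 B.+1).
by rewrite !big_mkord.
Qed.

(* k(k+1)/2, using the symmetry k |-> -1-k that exchanges [Posz n] and
   [Negz n]. *)
Definition itri k := match k with Posz n | Negz n => tri n end.

Lemma itri2 k : 2 * (itri k)%:Z = k * (k + 1).
Proof. by case: k => n /=; have := tri2 n; nia. Qed.

Lemma itri_box N B k : (itri k <= N)%N -> (N <= B)%N -> k \in ibox B.
Proof.
have n_tri n : (n <= tri n)%N by case: n => // n; rewrite triS leq_addl.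
by rewrite mem_ibox; case: k => n /=; have := n_tri n; lia.
Qed.

(* 3 k(k+1)/2 - d k; for d = 1, 2 these are the pentagonal numbers. *)
Definition pentexp d k :=
  match k with Posz n => (3 * tri n - d * n)%N | Negz n => (3 * tri n + d * n.+1)%N end.

Lemma pentexpE d k : (d <= 2)%N -> (pentexp d k)%:Z = 3 * (itri k)%:Z - d%:Z * k.
Proof.
case: k => n /= le_d2; have := tri2 n; last by nia.
by case: n => [|n]; first lia; nia.
Qed.

(** * The eighth power of the Euler product *)

Lemma mem_pairs (I J : eqType) (r : seq I) (s : seq J) x y :
  ((x, y) \in [seq (i, j) | i <- r, j <- s]) = (x \in r) && (y \in s).
Proof.
apply/allpairsP/andP => [[[i j] /= [ri sj [-> ->]]] // | [rx sy]].
by exists (x, y).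
Qed.

Section QSums.
Variable R : comUnitRingType.

Definition qsum (I : Type) (r : seq I) (e : I -> nat) (w : I -> int) : powerseries R :=
  \sum_(i <- r) (w i)%:~R * psX R ^+ e i.

Lemma coef_int (z : int) n : coefps (z%:~R : powerseries R) n = if n == 0 then z%:~R else 0.
Proof.
have natE m : coefps (m%:R : powerseries R) n = if n == 0 then m%:R else 0.
  elim: m => [|m IHm]; first by rewrite coefps0; case: eqP.
  by rewrite -!natr1 coefpsD IHm coefps1; case: eqP => _; rewrite ?addr0.
case: z => m; first by rewrite -!pmulrn natE.
by rewrite !NegzE !mulrNz coefpsN -!pmulrn natE; case: eqP => _; rewrite ?oppr0.
Qed.

Lemma coef_qsum (I : Type) (r : seq I) e w n :
  coefps (qsum r e w) n = \sum_(i <- r | e i == n) (w i)%:~R.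
Proof.
rewrite coefps_sum [RHS]big_mkcond; apply: eq_bigr => i _.
rewrite coefpsM big_ord_recl subn0 coef_int eqxx coefps_psXn big1.
  by rewrite addr0 [n == _]eq_sym; case: eqP => _; rewrite ?mulr1 ?mulr0.
by move=> j _; rewrite coef_int mul0r.
Qed.

Lemma qsumM (I J : Type) (r : seq I) (s : seq J) e e' w w' :
  qsum r e w * qsum s e' w' =
  qsum [seq (i, j) | i <- r, j <- s] (fun p => e p.1 + e' p.2)%N (fun p => w p.1 * w' p.2).
Proof.
rewrite /qsum big_distrlr big_allpairs; apply: eq_bigr => i _; apply: eq_bigr => j _.
by rewrite rmorphM exprD mulrACA.
Qed.

(** The maps are compared only at exponents up to N, because finite boxes need not correspond at
    their edges. *)
Lemma qsum_reindex (I J : eqType) N (r : seq I) (s : seq J) e e' w w'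
    (h : I -> J) (h' : J -> I) :
  uniq r -> uniq s ->
  (forall i, i \in r -> (e i <= N)%N ->
     [/\ h i \in s, e' (h i) = e i, w' (h i) = w i & h' (h i) = i]) ->
  (forall j, j \in s -> (e' j <= N)%N ->
     [/\ h' j \in r, e (h' j) = e' j & h (h' j) = j]) ->
  eqtrunc N (qsum r e w) (qsum s e' w').
Proof.
move=> Ur Us hP h'P n le_nN; rewrite !coef_qsum -[LHS]big_filter -[RHS]big_filter.
have hrP i : i \in [seq i <- r | e i == n] ->
    [/\ h i \in s, e' (h i) = e i, w' (h i) = w i & h' (h i) = i].
  by rewrite mem_filter => /andP[/eqP e_i r_i]; apply: hP; rewrite ?e_i.
have U : uniq (map h [seq i <- r | e i == n]).
  rewrite map_inj_in_uniq ?filter_uniq // => i i' /hrP[_ _ _ {2}<-] /hrP[_ _ _ {2}<-] ->.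
  by [].
rewrite (perm_big (map h [seq i <- r | e i == n])) /=.
  by rewrite big_map; apply: eq_big_seq => i /hrP[_ _ ->].
apply: uniq_perm => //; first exact: filter_uniq.
move=> j; rewrite mem_filter; apply/andP/mapP => [[/eqP e_j s_j]|[i ri ->]].
  have [] := h'P j s_j; first by rewrite e_j.
  by move=> r_j e_h hK; exists (h' j); rewrite // mem_filter e_h e_j eqxx.
by have [-> -> _ _] := hrP i ri; move: ri; rewrite mem_filter => /andP[].
Qed.

(** * Moments of the odd theta series *)

Definition isgn (k : int) : int := (-1) ^+ `|k|%N.

Lemma isgnE (k l m j : int) (d : nat) : k + l + m = 3 * j - d%:Z ->
  isgn k * isgn l * isgn m = (-1) ^+ d * isgn j.
Proof.
move=> e; rewrite /isgn -!exprD -[LHS]signr_odd -[RHS]signr_odd.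
have -> : odd (`|k| + `|l| + `|m|) = odd (d + `|j|) by lia.
by [].
Qed.

Definition oddtheta B i : powerseries R :=
  qsum (ibox B) itri (fun k => isgn k * (2 * k + 1) ^+ i).

Lemma isgn_pair (n : nat) : isgn (Negz n) = - isgn (Posz n).
Proof. by rewrite /isgn /= exprS mulN1r. Qed.

(** The reflection k |-> -1-k fixes the exponent and negates both (-1)^k and 2k + 1. *)
Lemma oddtheta_even B i : ~~ odd i -> oddtheta B i = 0.
Proof.
move=> even_i; rewrite /oddtheta /qsum big_ibox big1 // => n _ /=.
rewrite isgn_pair (_ : 2 * Negz n + 1 = - (2 * n%:Z + 1)); last by lia.
by rewrite exprNn -signr_odd (negbTE even_i) expr0 mul1r -mulrDl -rmorphD mulNr subrr mul0r.
Qed.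

Lemma oddtheta1 B : eqtrunc B (oddtheta B 1) (2 * euler R B ^+ 3).
Proof.
apply: (eqtrunc_trans _ (eqtruncM (@eqtrunc_refl _ B 2) (eqtrunc_sym (@euler_cube R B)))).
rewrite /oddtheta /qsum big_ibox mulr_sumr; apply: eqtrunc_sum => n _ /=.
apply: eq_eqtrunc.
rewrite isgn_pair (_ : 2 * Negz n + 1 = - (2 * n%:Z + 1)); last by lia.
rewrite !expr1 mulrNN -mulr2n -[_ *+ 2]mulr_natl; congr (_ * (_ * _)).
by rewrite rmorphM rmorphXn /= rmorphN1 rmorphD rmorphM /= -!pmulrn natrD natrM.
Qed.

(* The even moments vanish, hence only the odd part of a cubic weight counts. *)
Lemma oddtheta_comb B (u : powerseries R) (c0 c1 c2 c3 : int) e :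
  \sum_(k <- ibox B) (isgn k * (c0 + c1 * (2 * k + 1) + c2 * (2 * k + 1) ^+ 2
     + c3 * (2 * k + 1) ^+ 3))%:~R * u * psX R ^+ (e + itri k) =
  u * psX R ^+ e * (c1%:~R * oddtheta B 1 + c3%:~R * oddtheta B 3).
Proof.
transitivity (u * psX R ^+ e * (c0%:~R * oddtheta B 0 + c1%:~R * oddtheta B 1
   + c2%:~R * oddtheta B 2 + c3%:~R * oddtheta B 3)).
  rewrite /oddtheta /qsum !mulr_sumr -!big_split mulr_sumr; apply: eq_bigr => k _ /=.
  by rewrite exprD !rmorphM !rmorphD !rmorphM /= !expr0; ring.
by rewrite ![oddtheta B 0]oddtheta_even ?[oddtheta B 2]oddtheta_even // !mulr0 add0r addr0.
Qed.

(* Product of the projections of 3(k, l, m) orthogonally to (1, 1, 1): it is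
   invariant under translations along (1, 1, 1), and the coefficient of k l m in
   its expansion is 12. *)
Definition a2form k l m : int := (2 * k - l - m) * (2 * l - k - m) * (2 * m - k - l).
Definition a2weight k l m : int := a2form (2 * k + 1) (2 * l + 1) (2 * m + 1).

(** Only monomials odd in all three variables survive; in a cubic form k l m is the only one. *)
Lemma cubic_theta B :
  qsum [seq (k, p) | k <- ibox B, p <- [seq (l, m) | l <- ibox B, m <- ibox B]]
    (fun p => itri p.1 + itri p.2.1 + itri p.2.2)%N
    (fun p => isgn p.1 * isgn p.2.1 * isgn p.2.2 * a2weight p.1 p.2.1 p.2.2)
  = 12 * oddtheta B 1 ^+ 3.
Proof.
rewrite /qsum big_allpairs; set M1 := oddtheta B 1; set M3 := oddtheta B 3.
transitivity (\sum_(k <- ibox B) (isgn k * (0 + 12 * (2 * k + 1) + 0 * (2 * k + 1) ^+ 2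
    + 0 * (2 * k + 1) ^+ 3))%:~R * M1 ^+ 2 * psX R ^+ (0 + itri k)); last first.
  by rewrite oddtheta_comb -/M1; ring.
apply: eq_bigr => k _; rewrite big_allpairs /=; set a := 2 * k + 1.
(* After the sum over m, the part with [M3] carries no power of 2l + 1, so its sum over l is an even
   moment and vanishes. *)
transitivity (\sum_(l <- ibox B)
   ((isgn l * (- 3 * a ^+ 2 + 12 * a * (2 * l + 1) + - 3 * (2 * l + 1) ^+ 2
      + 0 * (2 * l + 1) ^+ 3))%:~R * ((isgn k)%:~R * M1) * psX R ^+ (itri k + itri l)
    + (isgn l * (1 + 0 * (2 * l + 1) + 0 * (2 * l + 1) ^+ 2
      + 0 * (2 * l + 1) ^+ 3))%:~R * ((isgn k)%:~R * (2 * M3)) * psX R ^+ (itri k + itri l))).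
  apply: eq_bigr => l _; set b := 2 * l + 1.
  have p_cubic m : isgn k * isgn l * isgn m * a2weight k l m = isgn k * isgn l *
      (isgn m * (- (2 * a - b) * (2 * b - a) * (a + b)
       + (2 * (2 * a - b) * (2 * b - a) + (a + b) ^+ 2) * (2 * m + 1)
       + (- 3 * (a + b)) * (2 * m + 1) ^+ 2 + 2 * (2 * m + 1) ^+ 3)).
    by rewrite /a2weight /a2form -/a -/b; ring.
  under eq_bigr => m _ do rewrite p_cubic rmorphM [_%:~R * _%:~R]mulrC.
  rewrite oddtheta_comb -/M1 -/M3.
  by rewrite !(rmorphM, rmorphD, rmorphN, rmorphXn, rmorph1) /=; ring.
rewrite big_split /= !oddtheta_comb -/M1 -/M3 add0n !(rmorphM, rmorphD) /=; ring.
Qed.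

(* The third coordinate of the points of the plane k + l + m = - d. *)
Definition a2third (d : nat) (k l : int) : int := - d%:Z - k - l.

(** The weight omits the sign, which is (-1)^d on the whole plane k + l + m = -d. *)
Definition a2series C d : powerseries R :=
  qsum [seq (k, l) | k <- ibox C, l <- ibox C]
    (fun p => itri p.1 + itri p.2 + itri (a2third d p.1 p.2))%N
    (fun p => a2weight p.1 p.2 (a2third d p.1 p.2)).

Definition pent C d : powerseries R := qsum (ibox C) (pentexp d) isgn.

Lemma pent0 C : pent C 0 = 0.
Proof.
rewrite /pent /qsum big_ibox big1 // => n _ /=.
by rewrite isgn_pair !mul0n addn0 subn0 -mulrDl -rmorphD subrr mul0r.
Qed.

(** The exponent separates because the cross term is j (k + l + m) = -d j. *)
Lemma pentexp_itri d j k l : (d <= 2)%N ->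
  (itri (k + j) + itri (l + j) + itri (a2third d k l + j))%N
  = (pentexp d j + (itri k + itri l + itri (a2third d k l)))%N.
Proof.
move=> le_d2; apply/eqP; rewrite -eqz_nat -(inj_eq (mulfI (isT : 2 != 0 :> int))).
rewrite !PoszD pentexpE // !mulrDr [2 * (3 * _)]mulrCA !itri2 /a2third.
by apply/eqP; ring.
Qed.

(* Writes (k, l, m) with k + l + m = 3j - d, 0 <= d < 3, as a translate by j of a
   point of the plane of sum - d. *)
Definition split_triple (p : int * (int * int)) : 'I_3 * (int * (int * int)) :=
  let s := p.1 + p.2.1 + p.2.2 in
  let d : 'I_3 := inord `|((- s) %% 3)%Z|%N in
  let j := ((s + d%:Z) %/ 3)%Z in
  (d, (j, (p.1 - j, p.2.1 - j))).

Definition join_triple (p : 'I_3 * (int * (int * int))) : int * (int * int) :=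
  let: (d, (j, (k, l))) := p in (k + j, (l + j, a2third d k l + j)).

Lemma split_tripleK : cancel split_triple join_triple.
Proof.
case=> k [l m]; rewrite /split_triple /join_triple /a2third /=.
rewrite inordK; last by lia.
by congr (_, (_, _)); lia.
Qed.

Lemma join_tripleK : cancel join_triple split_triple.
Proof.
case=> d [j [k l]]; rewrite /split_triple /join_triple /a2third /=.
have lt_d3 := ltn_ord d.
set e := inord _; have -> : e = d by apply: val_inj; rewrite /e /= inordK; lia.
have -> : ((k + j + (l + j) + (- d%:Z - k - l + j) + d%:Z) %/ 3)%Z = j by lia.
by congr (_, (_, (_, _))); lia.
Qed.

Lemma a2_split B C : (4 * B + 8 <= C)%N ->
  eqtrunc B (12 * oddtheta C 1 ^+ 3)
    (\sum_(d < 3) (-1) ^+ d * (pent C d * a2series C d)).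
Proof.
move=> le_BC; rewrite -cubic_theta.
have -> : \sum_(d < 3) (-1) ^+ d * (pent C d * a2series C d) =
  qsum [seq (d, p) | d <- enum 'I_3, p <- [seq (j, p) | j <- ibox C,
                p <- [seq (k, l) | k <- ibox C, l <- ibox C]]]
    (fun p => pentexp p.1 p.2.1 + (itri p.2.2.1 + itri p.2.2.2
                + itri (a2third p.1 p.2.2.1 p.2.2.2)))%N
    (fun p => (-1) ^+ p.1 * (isgn p.2.1 * a2weight p.2.2.1 p.2.2.2
                (a2third p.1 p.2.2.1 p.2.2.2))).
  rewrite [RHS]/qsum big_allpairs big_enum; apply: eq_bigr => d _.
  rewrite /pent /a2series qsumM /qsum mulr_sumr; apply: eq_bigr => p _ /=.
  by rewrite mulrA; congr (_ * _); rewrite [RHS]rmorphM rmorphXn rmorphN1.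
have box_uniq : uniq [seq (k, l) | k <- ibox C, l <- ibox C].
  by apply: allpairs_uniq; rewrite ?ibox_uniq // => -[? ?] [? ?] _ _ [-> ->].
apply: (qsum_reindex (h := split_triple) (h' := join_triple)).
- by apply: allpairs_uniq; rewrite ?ibox_uniq // => -[? ?] [? ?] _ _ [-> ->].
- apply: allpairs_uniq; rewrite ?enum_uniq //; last by move=> [? ?] [? ?] _ _ [-> ->].
  by apply: allpairs_uniq; rewrite ?ibox_uniq // => -[? ?] [? ?] _ _ [-> ->].
- move=> p _; have := split_tripleK p; case: (split_triple p) => d [j [k l]] <-.
  have lt_d3 := ltn_ord d.
  move=> le_B; rewrite /= in le_B; split => [|/=|/=|].
  (* Coordinates in the box of B bound j, k and l by 2B + 1 in absolute value, inside the box of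
     C. *)
  + have bd z : (itri z <= B)%N -> - (B%:Z + 1) <= z <= B%:Z.
      by move=> le_zB; rewrite -mem_ibox (itri_box le_zB).
    have := bd (k + j); have := bd (l + j); have := bd (a2third d k l + j).
    move=> /(_ ltac:(lia)) + /(_ ltac:(lia)) + /(_ ltac:(lia)).
    rewrite /a2third => b1 b2 b3.
    have d_enum : d \in enum 'I_3 by rewrite mem_enum.
    by rewrite !mem_pairs d_enum !mem_ibox; lia.
  + by rewrite pentexp_itri.
  + rewrite (@isgnE _ _ _ j d); last by rewrite /a2third; lia.
    by rewrite -mulrA; congr (_ * (_ * _)); rewrite /a2weight /a2form; ring.
  + by [].
- case=> d [j [k l]] _ le_B; have lt_d3 := ltn_ord d.
  rewrite /= -pentexp_itri // in le_B.
  split => [|/=|]; last exact: join_tripleK (d, (j, (k, l))).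
    by rewrite /join_triple !mem_pairs !(@itri_box B) //; lia.
  by rewrite pentexp_itri.
Qed.

(** [Posz] and [Negz] indices run through the two branches of pentagonal numbers; d = 2 exchanges
    the branches with a shift by one. The last negative index has exponent above C. *)
Lemma pent_euler C d : (0 < d <= 2)%N -> eqtrunc C (pent C d) (euler R C).
Proof.
move=> d12; apply: (eqtrunc_trans _ (eqtrunc_sym (@euler_pentagonal R C))).
have isgn_nat (n : nat) : (isgn n)%:~R = (-1) ^+ n :> powerseries R.
  by rewrite /isgn rmorphXn rmorphN1.
have isgn_Negz (n : nat) : (isgn (Negz n))%:~R = (-1) ^+ n.+1 :> powerseries R.
  by rewrite /isgn rmorphXn rmorphN1.
set last_term : powerseries R := (-1) ^+ C.+1 * psX R ^+ (3 * tri C + d * C.+1).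
have -> : pent C d = \sum_(n < C.+1) (-1) ^+ n * psX R ^+ (3 * tri n - d * n)
    + (\sum_(n < C) (-1) ^+ n.+1 * psX R ^+ (3 * tri n + d * n.+1) + last_term).
  rewrite /pent /qsum big_ibox big_split [X in _ + X = _]big_ord_recr isgn_Negz.
  by congr (_ + (_ + _)); apply: eq_bigr => n _; rewrite ?isgn_nat ?isgn_Negz.
have last0 : eqtrunc C last_term 0.
  by rewrite /last_term mulrC; apply: eqtruncXn0; nia.
have {}d12 : d = 1%N \/ d = 2%N by lia.
case: d12 last_term last0 => -> last_term last0.
- rewrite addrA -[X in eqtrunc _ _ X]addr0; apply: eqtruncD => //; apply: eq_eqtrunc.
  by congr (_ + _); apply: eq_bigr => n _; rewrite mul1n.
- rewrite addrA -[X in eqtrunc _ _ X]addr0; apply: eqtruncD => //; apply: eq_eqtrunc.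
  rewrite big_ord_recl [in RHS]big_ord_recl -!addrA; congr (_ + _); rewrite addrC.
  by congr (_ + _); apply: eq_bigr => n _; congr (_ * _ ^+ _); rewrite /= /bump ?triS; lia.
Qed.

(** Here 96 = 12 * 2^3. In [a2_split] the part d = 0 vanishes and the others contain a factor phi,
    which is cancelled. *)
Lemma euler8_a2 B C : (4 * B + 8 <= C)%N ->
  eqtrunc B (96 * euler R C ^+ 8) (a2series C 2 - a2series C 1).
Proof.
move=> le_BC; rewrite -[96 * _](mulrK (euler_unit R C)) -[_ - _](mulrK (euler_unit R C)).
apply: eqtruncM => //.
have le_C : (B <= C)%N by lia.
have t1 : eqtrunc B (96 * euler R C ^+ 8 * euler R C) (12 * oddtheta C 1 ^+ 3).
  have -> : 96 * euler R C ^+ 8 * euler R C = 12 * (2 * euler R C ^+ 3) ^+ 3 by ring.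
  apply: (eqtrunc_le le_C); apply: eqtruncM => //; apply: eqtruncX.
  exact/eqtrunc_sym/oddtheta1.
apply: (eqtrunc_trans t1); apply: (eqtrunc_trans (a2_split le_BC)).
rewrite !big_ord_recl big_ord0 /= /bump /= !add1n pent0 mul0r mulr0 add0r addr0.
have -> : (a2series C 2 - a2series C 1) * euler R C =
   (-1) ^+ 1 * (euler R C * a2series C 1) + (-1) ^+ 2 * (euler R C * a2series C 2) by ring.
apply: (eqtrunc_le le_C); apply: eqtruncD; apply: eqtruncM => //; apply: eqtruncM => //;
  exact: pent_euler.
Qed.
End QSums.

(** * Reduction modulo 11 *)

(** The last-digit case of Lucas's theorem: Pascal's rule lowers n mod p down to 0, where m C(n, m)
    = n C(n-1, m-1) decides. *)
Lemma dvdn_bin_modn p n m : prime p -> (n %% p < m %% p)%N -> (p %| 'C(n, m))%N.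
Proof.
move=> p_pr; move e: (n %% p)%N => r.
elim: r n m e => [|r IHr] n m e lt_rm.
  have m_gt0 : (0 < m)%N by case: m lt_rm => //; rewrite mod0n.
  have : (p %| m * 'C(n, m))%N.
    case: n e => [_|n e]; first by rewrite bin0n eqn0Ngt m_gt0 muln0.
    by case: m {lt_rm} m_gt0 => // m _; rewrite -mul_bin_diag dvdn_mulr // /dvdn e.
  by rewrite Euclid_dvdM // /dvdn (gtn_eqF lt_rm).
have p_gt0 := prime_gt0 p_pr.
have lt_mp : (m %% p < p)%N by rewrite ltn_pmod.
have modS a b : (a %% p = b.+1)%N -> (a.-1 %% p = b)%N /\ (a = a.-1.+1)%N.
  move=> ab; have lt_bp : (b.+1 < p)%N by rewrite -ab ltn_pmod.
  have eq_a : a = (a %/ p * p + b.+1)%N by rewrite -ab -divn_eq.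
  rewrite eq_a addnS /= modnMDl modn_small //; exact: ltnW.
have [n1 ->] := modS _ _ e.
have [|m1 eq_m] := modS m (m %% p).-1; first by rewrite prednK // (leq_ltn_trans _ lt_rm).
rewrite eq_m binS dvdn_add // IHr // ?m1; last by rewrite -ltnS prednK // (leq_ltn_trans _ lt_rm).
by rewrite -eq_m ltnW.
Qed.

(** Since 2t + 1 = 9 is invertible mod 11, consider (2n + 1) C(n+t, 2t), with 2t = 8. The binomial
    vanishes unless n = 4, 5, 6; at n = 5 the factor 2n + 1 does. *)
Lemma jac_coef_dvd n t : (t %% 11 = 4)%N -> (tri n %% 11 != 10)%N ->
  (11 %| 'C(n + t + 1, 2 * t + 1) + 'C(n + t, 2 * t + 1))%N.
Proof.
move=> t4 tri10.
have e : ((2 * t + 1) * ('C(n + t + 1, 2 * t + 1) + 'C(n + t, 2 * t + 1))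
   = (2 * n + 1) * 'C(n + t, 2 * t))%N.
  rewrite mulnDr !addn1 -mul_bin_diag mul_bin_left -mulnDl; case: (leqP t n) => lt_tn.
    by congr (_ * _)%N; lia.
  by rewrite bin_small ?muln0 //; lia.
have: (11 %| (2 * t + 1) * ('C(n + t + 1, 2 * t + 1) + 'C(n + t, 2 * t + 1)))%N.
  rewrite e; case: (ltnP ((n + t) %% 11) 8) => [lt8|ge8].
    by rewrite dvdn_mull // dvdn_bin_modn //; lia.
  have n5 : (n %% 11 = 5)%N.
    have : (n %% 11 = 4 \/ n %% 11 = 5 \/ n %% 11 = 6)%N by lia.
    case=> [n4|[//|n6]]; exfalso; move: tri10; have := tri2 n; move: (tri n) => T.
      (* As 20 = 4 * 5, this makes tri n = 10 modulo 11; likewise 42 = 6 * 7 below. *)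
      have [k ->] : exists k, (n * n.+1 = 11 * k + 20)%N; last by lia.
      rewrite (divn_eq n 11) n4; move: (n %/ 11)%N => q.
      by exists (11 * (q * q) + 9 * q)%N; ring.
    have [k ->] : exists k, (n * n.+1 = 11 * k + 42)%N; last by lia.
    rewrite (divn_eq n 11) n6; move: (n %/ 11)%N => q.
    by exists (11 * (q * q) + 13 * q)%N; ring.
  by rewrite dvdn_mulr //; lia.
by rewrite Gauss_dvdr // /coprime -gcdn_modr (_ : (2 * t + 1) %% 11 = 9)%N //; lia.
Qed.

Section Reduction.
Variable R : comUnitRingType.

Definition psintr (f : powerseries int) : powerseries R :=
  PowerSeries (fun n => (coefps f n)%:~R).

Lemma psintr_is_additive : zmod_morphism psintr.
Proof. by move=> f g; apply: psP => n /=; rewrite rmorphB. Qed.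
Lemma psintr_is_monoid_morphism : monoid_morphism psintr.
Proof.
split=> [|f g]; apply: psP => n; first by rewrite /= rmorph_nat.
by rewrite /= rmorph_sum; apply: eq_bigr => i _; rewrite rmorphM.
Qed.
HB.instance Definition _ :=
  GRing.isZmodMorphism.Build (powerseries int) (powerseries R) psintr psintr_is_additive.
HB.instance Definition _ :=
  GRing.isMonoidMorphism.Build (powerseries int) (powerseries R) psintr psintr_is_monoid_morphism.

Lemma psintrX : psintr (psX int) = psX R.
Proof. by apply: psP => n /=; rewrite rmorph_nat. Qed.

Lemma psintr_trunc N f g : eqtrunc N f g -> eqtrunc N (psintr f) (psintr g).
Proof. by move=> fg n le_nN /=; rewrite fg. Qed.

Lemma MO_euler_intr t B :
  eqtrunc B (euler R B ^+ 3 * psintr (MO_series (-2) t))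
   (qsum R (index_iota 0 B.+1) tri (fun n =>
      (-1) ^+ (n + t) * ('C(n + t + 1, 2 * t + 1) + 'C(n + t, 2 * t + 1))%:Z)).
Proof.
have eulerE : psintr (euler int B) = euler R B.
  rewrite /euler rmorph_prod; apply: eq_bigr => m _.
  by rewrite rmorphB rmorph1 rmorphXn /= psintrX.
have := psintr_trunc (@MO_euler t B); rewrite rmorphM rmorphXn /= eulerE => /eqtrunc_trans; apply.
rewrite rmorph_sum /qsum big_mkord; apply: eq_eqtrunc; apply: eq_bigr => n _.
rewrite rmorphM rmorphXn /= psintrX coef_jac rmorphM rmorphXn rmorphN1 rmorph_nat.
by rewrite rmorphM rmorphXn rmorphN1 /= -pmulrn.
Qed.
End Reduction.

(** * Vanishing coefficients of phi^8 and phi^11 modulo 11 *)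

Lemma subr_cube (K : comPzRingType) (a b : K) :
  a ^+ 3 - b ^+ 3 = (a - b) * (a ^+ 2 + a * b + b ^+ 2).
Proof. by ring. Qed.

(* Cubing is injective on F_11, so a^2 + ab + b^2 is anisotropic there. *)
Lemma F11_eisenstein (a b : 'F_11) : a ^+ 2 + a * b + b ^+ 2 = 0 -> a = 0.
Proof.
move=> e.
have cubeK (x : 'F_11) : (x ^+ 3) ^+ 7 = x.
  have x11 : x ^+ 11 = x by have := expf_card x; rewrite card_Fp.
  (* Cubing is inverted by the 7th power since 21 = 1 modulo 10; the splitting 11 + 10 also covers x
     = 0. *)
  by rewrite -exprM (_ : (3 * 7 = 11 + 10)%N) // exprD {1}x11 -exprS x11.
have ab : a = b.
  rewrite -(cubeK a) -(cubeK b); congr (_ ^+ _); apply/eqP.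
  by rewrite -subr_eq0 subr_cube e mulr0.
have /eqP : a ^+ 2 *+ 3 = 0 by rewrite -[RHS]e -ab -expr2 !mulrSr mulr0n add0r.
by rewrite -mulr_natl mulf_eq0 expf_eq0 /= => /eqP.
Qed.

(** For d = 1, 2 and exponent e, x = 3k + d and y = 3l + d satisfy x^2 + xy + y^2 = 9e + 3, which is
    66 = 0 modulo 11 when e = 7. *)
Lemma a2series_mod11 C d n : (d = 1 \/ d = 2)%N -> (n %% 11 = 7)%N ->
  coefps (a2series 'F_11 C d) n = 0.
Proof.
move=> d12 n7; rewrite coef_qsum big1_seq //= => -[k l] /andP[/eqP/= e _].
have alpha : 2 * k - l - a2third d k l = 3 * k + d%:Z by rewrite /a2third; ring.
suff alpha0 : (2 * k - l - a2third d k l)%:~R = 0 :> 'F_11.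
  (* By translation invariance 2k + 1 may be replaced by 2k, and 8 = 2^3 by homogeneity. *)
  have -> : a2weight k l (a2third d k l) = (2 * k - l - a2third d k l) *
     (8 * (2 * l - k - a2third d k l) * (2 * a2third d k l - k - l)).
    by rewrite /a2weight /a2form; ring.
  by rewrite rmorphM /= alpha0 mul0r.
rewrite alpha; apply: (@F11_eisenstein _ (3 * l + d%:Z)%:~R).
rewrite -!rmorphXn -rmorphM -!rmorphD /=.
have -> : (3 * k + d%:Z) ^+ 2 + (3 * k + d%:Z) * (3 * l + d%:Z) + (3 * l + d%:Z) ^+ 2
    = 11 * (9 * (n %/ 11)%N%:Z + 6).
  have : n = (11 * (n %/ 11) + 7)%N by lia.
  move: (n %/ 11)%N => q nq.
  have := itri2 k; have := itri2 l; have := itri2 (a2third d k l).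
  move: e; rewrite nq /a2third !expr2.
  by case: d12 => ->; nia.
by rewrite rmorphM /= (_ : 11%:~R = 0) ?mul0r //; apply/eqP.
Qed.

(** [euler8_a2] needs the larger bound C, which leaves coefficients up to B unchanged; 96 is
    invertible mod 11. *)
Lemma euler8_mod11 B n : (n <= B)%N -> (n %% 11 = 7)%N ->
  coefps (euler 'F_11 B ^+ 8) n = 0.
Proof.
move=> le_nB n7; pose C := (4 * B + 8)%N.
have -> : coefps (euler 'F_11 B ^+ 8) n = coefps (euler 'F_11 C ^+ 8) n.
  by apply: (eqtruncX 8 (eqtrunc_sym (@euler_trunc _ B C _))); rewrite /C; lia.
have := @euler8_a2 'F_11 B C (leqnn _) n le_nB.
rewrite coefpsD coefpsN !a2series_mod11 ?subr0; [|by auto..].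
have -> : 96 = psC (96 : 'F_11).
  by apply: psP => i; rewrite -[96]/((96 : int)%:~R) coef_int.
rewrite coefpsCM; move: (coefps _ n) => x /eqP; rewrite mulf_eq0 => /orP[|/eqP //].
by rewrite -(dvdn_pcharf (pchar_Fp (isT : prime 11))).
Qed.

(** By Frobenius, (1 - q^m)^11 = 1 - q^(11m). *)
Lemma euler11_mod11 B n : ~~ (11 %| n)%N -> coefps (euler 'F_11 B ^+ 11) n = 0.
Proof.
have ch : 11%N \in [pchar powerseries 'F_11].
  apply/andP; split => //; apply/eqP/psP => i.
  by rewrite -[11%:R]/((11 : int)%:~R) coef_int; case: eqP => _ //; apply/eqP.
elim: B n => [|B IHB] n ndvd.
  rewrite euler0 expr1n coefps1; case: eqP => // n0.
  by rewrite n0 in ndvd.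
rewrite eulerS exprMn -(pFrobenius_autE ch (1 - _)) pFrobenius_autB_comm; last exact: mulrC.
rewrite pFrobenius_aut1 pFrobenius_autE -exprM coefpsM big1 // => i _.
case: (boolP (11 %| i)%N) => [dvdi|/IHB ->]; last by rewrite mul0r.
have ndvd' : ~~ (11 %| n - i)%N.
  by apply: contra ndvd => d'; rewrite -(subnKC (_ : (i <= n)%N)) ?dvdn_add // -ltnS.
rewrite coefpsD coefpsN coefps1 coefps_psXn; case: eqP => [e|_].
  by rewrite e in ndvd'.
case: eqP => [e|_]; last by rewrite subr0 mulr0.
by rewrite e dvdn_mull in ndvd'.
Qed.

Theorem theorem6p4 :
  forall J N : nat,
    (MO (-2) (11 * J + 4) (11 * N + 6) = 0 %[mod 11])%Z.
Proof.
move=> J N; set t := (11 * J + 4)%N.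
suff MO0 n : (n %% 11 = 6)%N -> coefps (psintr 'F_11 (MO_series (-2) t)) n = 0.
  have := MO0 (11 * N + 6)%N; rewrite /MO /=; set z := coefps _ _ => z0.
  have {}z0 : z%:~R = 0 :> 'F_11 by apply: z0; lia.
  apply/eqP; rewrite eqz_mod_dvd subr0.
  by rewrite (dvdz_pcharf (pchar_Fp (isT : prime 11))) z0.
(* As phi^11 lives on multiples of 11, its product with the series at n involves only coefficients
   at n - 11j, known to vanish for j > 0. *)
elim/ltn_ind: n => n IHn n6.
set f := psintr _ _ in IHn *; set phi := euler 'F_11 n.
set theta := qsum 'F_11 (index_iota 0 n.+1) tri (fun n =>
      (-1) ^+ (n + t) * ('C(n + t + 1, 2 * t + 1) + 'C(n + t, 2 * t + 1))%:Z).
have theta10 i : (i %% 11 != 10)%N -> coefps theta i = 0.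
  move=> i10; rewrite coef_qsum big1 // => k /eqP tri_k.
  rewrite rmorphM /=; apply/eqP; rewrite mulf_eq0; apply/orP; right.
  rewrite -(dvdz_pcharf (pchar_Fp (isT : prime 11))) dvdzE.
  by apply: jac_coef_dvd; rewrite ?tri_k // /t; lia.
have : coefps (phi ^+ 11 * f) n = 0.
  have -> : coefps (phi ^+ 11 * f) n = coefps (phi ^+ 8 * theta) n.
    rewrite (_ : _ * f = phi ^+ 8 * (phi ^+ 3 * f)); last by rewrite mulrA -exprD.
    by apply: (eqtruncM (@eqtrunc_refl _ n _) (@MO_euler_intr _ t n)).
  rewrite coefpsM big1 // => i _; have := ltn_ord i; rewrite ltnS => le_in.
  (* [theta] lives on exponents 10 modulo 11; with n = 6 this forces i = 7 modulo 11. *)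
  case: (eqVneq ((n - i) %% 11)%N 10%N) => [e|/theta10 ->]; last by rewrite mulr0.
  by rewrite euler8_mod11 ?mul0r //; lia.
rewrite coefpsM big_ord_recl subn0 big1 => [|i _].
  have phi0 k : coefps (phi ^+ k) 0 = 1.
    by elim: k => // k IHk; rewrite exprS coefps0M euler_coef0 IHk mul1r.
  by rewrite phi0 mul1r addr0.
rewrite lift0; case: (boolP (11 %| i.+1)%N) => [dvdi|/euler11_mod11 ->]; last by rewrite mul0r.
by rewrite IHn ?mulr0 //; have := ltn_ord i; lia.
Qed.
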